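(* Define the Yellowstone sequence $(a(n))_{n\ge 1}$ by $a(1)=1$, $a(2)=2$, $a(3)=3$, and, for each $n>3$, let $a(n)$ be the smallest positive integer $k$ not in $\{a(1),\dots,a(n-1)\}$ such that $\gcd(a(n-2),k)>1$ and $\gcd(a(n-1),k)=1$. Then the sequence $(a(n))_{n\ge1}$ is a permutation of the positive integers, i.e. every positive integer occurs in it exactly once.
   Context: The sequence is OEIS A098550; it is the lexicographically earliest sequence of distinct positive integers with $a(1)=1,a(2)=2,a(3)=3$ satisfying $\gcd(a(n-2),a(n))>1$ and $\gcd(a(n-1),a(n))=1$ for all $n>3$. *)

(* Defs.v *)
From mathcomp Require Import all_boot.

Set Implicit Arguments.
Unset Strict Implicit.
Unset Printing Implicit Defensive.

(* Sequences (a(n))_{n >= 1} are functions nat -> nat; the value a 0 is never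
   inspected.  In particular iota 1 n.-1 enumerates 1, ..., n - 1. *)
Definition yellowstone_candidate (a : nat -> nat) (n k : nat) : bool :=
  [&& 0 < k,
      k \notin [seq a i | i <- iota 1 n.-1],
      1 < gcdn (a (n - 2)) k
    & gcdn (a (n - 1)) k == 1].

Definition is_yellowstone (a : nat -> nat) : Prop :=
  [/\ a 1 = 1, a 2 = 2, a 3 = 3
    & forall n, 3 < n ->
        yellowstone_candidate a n (a n) /\
        (forall k, yellowstone_candidate a n k -> a n <= k)].

(* The rest of this file shows that is_yellowstone determines exactly one
   sequence on the positive indices, as the recursive definition requires. *)

Lemma is_yellowstone_unique (a b : nat -> nat) :
  is_yellowstone a -> is_yellowstone b -> forall n, 0 < n -> a n = b n.
Proof.
move=> [a1 a2 a3 ha] [b1 b2 b3 hb]; elim/ltn_ind=> n IHn n_gt0.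
case: (ltnP 3 n) => [n_gt3|]; last first.
  by case: n n_gt0 {IHn} => [|[|[|[|n]]]] // _ _; rewrite ?a1 ?a2 ?a3 ?b1 ?b2 ?b3.
have eqc k : yellowstone_candidate a n k = yellowstone_candidate b n k.
  rewrite /yellowstone_candidate (IHn (n - 2)) ?(IHn (n - 1)).
  - congr [&& _, k \notin _, _ & _]; apply/eq_in_map => i.
    rewrite mem_iota add1n prednK // => /andP[i_gt0 lt_in].
    exact: IHn.
  - by rewrite ltn_subrL n_gt0.
  - by rewrite subn_gt0 (leq_trans _ n_gt3).
  - by rewrite ltn_subrL n_gt0.
  - by rewrite subn_gt0 (leq_trans _ n_gt3).
have [ca ma] := ha n n_gt3; have [cb mb] := hb n n_gt3.
by apply/eqP; rewrite eqn_leq ma ?mb // ?eqc // -eqc.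
Qed.

Section Existence.

(* Prefixes are stored in reverse order, so the last two terms come first. *)
Let cand (s : seq nat) k :=
  [&& 0 < k, k \notin s, 1 < gcdn (nth 0 s 1) k & gcdn (nth 0 s 0) k == 1].

Let inv (s : seq nat) :=
  [&& 1 < nth 0 s 0, 1 < nth 0 s 1 & coprime (nth 0 s 0) (nth 0 s 1)].

Let cand_ex s : inv s -> exists k, cand s k.
Proof.
case/and3P; set x := nth 0 s 0; set y := nth 0 s 1 => x_gt1 y_gt1 co_xy.
pose t := [seq y ^ i.+1 | i <- iota 0 (size s).+1].
have t_uniq : uniq t.
  by rewrite map_inj_uniq ?iota_uniq // => i j /(expnI y_gt1) [].
have /allPn[k /mapP[i _ ->] ks] : ~~ all (mem s) t.
  apply/negP => /allP sub_ts; have := uniq_leq_size t_uniq sub_ts.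
  by rewrite size_map size_iota ltnn.
exists (y ^ i.+1); rewrite /cand -/x -/y ks expn_gt0 (ltnW y_gt1) /=.
by rewrite -/(coprime _ _) coprimeXr // andbT expnS (gcdn_idPl (dvdn_mulr _ _)).
Qed.

Let inv_next s k : inv s -> cand s k -> inv (k :: s).
Proof.
case/and3P=> x_gt1 _ _ /and4P[k_gt0 _ gyk gxk]; rewrite /inv /= x_gt1 /=.
rewrite coprime_sym /coprime gxk andbT.
by rewrite (leq_trans gyk) // dvdn_leq // dvdn_gcdr.
Qed.

Let next_cand s (hs : inv s) : cand s (ex_minn (cand_ex hs)).
Proof. by case: ex_minnP. Qed.

Let next (u : {s | inv s}) : {s | inv s} :=
  let k := ex_minn (cand_ex (svalP u)) in
  exist _ (k :: sval u)
    (inv_next (svalP u)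
       (next_cand (svalP u))).

Let st n := sval (iter n next (exist inv [:: 3; 2; 1] isT)).

Let a n := if n < 4 then n else head 0 (st (n - 3)).

Let stE n : st n = rev [seq a i | i <- iota 1 n.+3].
Proof.
elim: n => [//|n IHn].
rewrite -[n.+1.+3]addn1 iotaD map_cat rev_cat -IHn add1n.
by rewrite [rev _]/= /a /=.
Qed.

Lemma is_yellowstone_exists : exists b, is_yellowstone b.
Proof.
exists a; split=> // n; case: n => [|[|[|[|n]]]] // _.
have eqc k : yellowstone_candidate a n.+4 k = cand (st n) k.
  rewrite /yellowstone_candidate /cand stE mem_rev !nth_rev ?size_map ?size_iota //.
  by rewrite !(nth_map 0) ?size_iota ?nth_iota ?subn1 ?subn2.
have -> : a n.+4 = head 0 (st n.+1) by rewrite /a subSS subSS subSS subn0.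
rewrite /st /=; case: ex_minnP => m cm min_m; split=> [|k]; rewrite eqc //.
exact: min_m.
Qed.

End Existence.

(* Main.v *)
(* Injectivity makes a(n) tend to infinity, so a number k that never occurs is
   eventually never a candidate.  If the terms had only finitely many prime
   factors, then for a new prime q the number p q, with p a prime factor of
   a(n - 2), would be a bounded candidate at every step; so arbitrarily large
   primes divide terms.  If a prime p stopped dividing terms, then p^e would be
   a cheaper substitute for a large prime q at the first term k q divisible by
   q; so every prime divides infinitely many terms.  Finally, if k is missing,
   then for large n a common factor of k and a(n) forces one of k and a(n + 1),
   hence of k and every later term.  For k prime this contradicts the
   coprimality of consecutive terms, so all primes occur; and then, for k
   arbitrary, it contradicts the occurrence of large primes. *)

Require Import Defs.
From mathcomp Require Import all_boot.
From Stdlib Require Import Classical.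

Set Implicit Arguments.
Unset Strict Implicit.
Unset Printing Implicit Defensive.

(** Induction on the bound: at most one positive index takes the value just reached, and beyond that
    index the lower bound rises by one. Index 0 is excluded because [a 0] is arbitrary. *)
Lemma injective_unbounded (f : nat -> nat) :
  {in [pred n | 0 < n] &, injective f} ->
  forall B, exists N, forall n, N <= n -> B < f n.
Proof.
move=> f_inj B.
suff [N hN] : exists N, forall n, N <= n -> B.+1 <= f n by exists N.
elim: B.+1 => [|{}B [N hN]]; first by exists 0.
case: (classic (exists2 m, 0 < m & f m = B)) => [[m m_gt0 fm]|noB].
  exists (maxn N m.+1) => n; rewrite geq_max => /andP[le_Nn lt_mn].
  rewrite ltn_neqAle hN // andbT; apply/eqP => fn.
  have /f_inj : f m = f n by rewrite fm fn.
  rewrite !inE m_gt0 (leq_ltn_trans _ lt_mn) // => /(_ isT isT) eq_mn.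
  by rewrite eq_mn ltnn in lt_mn.
exists (maxn N 1) => n; rewrite geq_max => /andP[le_Nn n_gt0].
rewrite ltn_neqAle hN // andbT; apply/eqP => fn.
by apply: noB; exists n.
Qed.

Lemma gcdn_gt1_dvd p m n : 1 < p -> 0 < n -> p %| m -> p %| n -> 1 < gcdn m n.
Proof.
move=> p_gt1 n_gt0 pm pn; apply: (leq_trans p_gt1).
by apply: dvdn_leq; rewrite ?gcdn_gt0 ?n_gt0 ?orbT // dvdn_gcd pm pn.
Qed.

Section Yellowstone.

Variables (a : nat -> nat) (ha : is_yellowstone a).

Lemma yellowstone_stepP n : 3 < n ->
  [/\ 0 < a n, forall i, 0 < i < n -> a i != a n,
      1 < gcdn (a (n - 2)) (a n) & coprime (a (n - 1)) (a n)].
Proof.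
case: ha => _ _ _ H n_gt3; have [/and4P[an_gt0 fresh g1 co] _] := H n n_gt3.
split=> // i /andP[i_gt0 lt_in]; apply: contraNneq fresh => <-.
by apply: map_f; rewrite mem_iota i_gt0 add1n (ltn_predK n_gt3).
Qed.

Lemma yellowstone_min n k : 3 < n -> 0 < k ->
  (forall i, 0 < i < n -> a i != k) ->
  1 < gcdn (a (n - 2)) k -> coprime (a (n - 1)) k -> a n <= k.
Proof.
case: ha => _ _ _ H n_gt3 k_gt0 fresh g1 co; have [_] := H n n_gt3; apply.
apply/and4P; split=> //; apply/mapP => -[i].
rewrite mem_iota add1n (ltn_predK n_gt3) => /fresh neq_ik eq_ik.
by rewrite eq_ik eqxx in neq_ik.
Qed.

Lemma yellowstone_gt1 n : 1 < n -> 1 < a n.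
Proof.
case: (ltnP 3 n) => [/yellowstone_stepP[an_gt0 _ g1 _] _|].
  by apply: (leq_trans g1); rewrite dvdn_leq ?dvdn_gcdr.
by case: ha n => a1 a2 a3 _ [|[|[|[|n]]]] // _ _; rewrite ?a2 ?a3.
Qed.

Lemma yellowstone_gt0 n : 0 < n -> 0 < a n.
Proof.
case: ha => a1 _ _ _; case: n => [|[|n]] // _; first by rewrite a1.
exact/ltnW/yellowstone_gt1.
Qed.

Lemma yellowstone_coprime n : 0 < n -> coprime (a n) (a n.+1).
Proof.
case: (ltnP 3 n.+1) => [/yellowstone_stepP[_ _ _] + _|]; first by rewrite subn1.
by case: ha n => a1 a2 a3 _ [|[|[|n]]] // _ _; rewrite ?a1 ?a2 ?a3.
Qed.

Lemma yellowstone_inj : {in [pred n | 0 < n] &, injective a}.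
Proof.
have neq i n : 0 < i < n -> a i != a n.
  case: (ltnP 3 n) => [/yellowstone_stepP[_ + _ _]|]; first exact.
  by case: ha n i => a1 a2 a3 _ [|[|[|[|n]]]] // [|[|[|i]]] // _ _;
    rewrite ?a1 ?a2 ?a3.
move=> i j; rewrite !inE => i_gt0 j_gt0 eq_ij.
by case: (ltngtP i j) => // lt; [have := neq i j | have := neq j i];
  rewrite ?i_gt0 ?j_gt0 lt eq_ij eqxx => /(_ isT).
Qed.

Lemma yellowstone_large_prime B :
  exists q n, [/\ prime q, B < q, 0 < n & q %| a n].
Proof.
apply: NNPP => no_prime.
have [q lt_Bq q_pr] := prime_above B.
have no_dvd p n : prime p -> 0 < n -> p %| a n -> p <= B.
  move=> p_pr n_gt0 p_dvd; rewrite leqNgt; apply/negP => lt_Bp.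
  by apply: no_prime; exists p, n.
have q_ndvd n : 0 < n -> ~~ (q %| a n).
  by move=> n_gt0; apply/negP => /(no_dvd _ _ q_pr n_gt0); rewrite leqNgt lt_Bq.
(* Every prime dividing a term is at most [B], so [B * q] bounds all the candidates [p * q] used
   below. *)
have [N large] := injective_unbounded yellowstone_inj (B * q).
have [n le_Nn n_gt3] : exists2 n, N <= n & 3 < n.
  by exists (maxn N 4); rewrite ?leq_maxl ?leq_maxr.
have:= large n le_Nn; rewrite ltnNge => /negP; apply.
have n2_gt1 : 1 < n - 2 by rewrite ltn_subRL.
have n1_gt0 : 0 < n - 1 by rewrite subn_gt0 (leq_trans _ n_gt3).
have eq_n1 : (n - 2).+1 = n - 1 by rewrite -subSn ?subSS // (leq_trans _ n_gt3).
have p_pr := pdiv_prime (yellowstone_gt1 n2_gt1).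
set p := pdiv _ in p_pr; have p_dvd : p %| a (n - 2) by apply: pdiv_dvd.
have pq_gt0 : 0 < p * q by rewrite muln_gt0 !prime_gt0.
apply: (@leq_trans (p * q)).
  apply: yellowstone_min => //.
  - move=> i /andP[i_gt0 _]; apply: contraNneq (q_ndvd i i_gt0) => ->.
    exact: dvdn_mull.
  - by apply: gcdn_gt1_dvd p_dvd (dvdn_mulr _ _); rewrite ?prime_gt1.
  (* [q] divides no term, and [p] divides [a (n - 2)], which is coprime to [a (n - 1)]. *)
  - rewrite coprimeMr [X in _ && X]coprime_sym (prime_coprime _ q_pr) q_ndvd // andbT.
    rewrite coprime_sym -eq_n1.
    by apply: coprime_dvdl p_dvd _; apply: yellowstone_coprime; apply: ltnW.
by rewrite leq_mul2r (no_dvd p (n - 2)) ?orbT // ltnW.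
Qed.

Lemma yellowstone_prime_infinitely_often p N :
  prime p -> exists2 n, N <= n & p %| a n.
Proof.
move=> p_pr; apply: NNPP => none.
have p_ndvd n : N <= n -> ~~ (p %| a n).
  by move=> le_Nn; apply/negP => p_dvd; apply: none; exists n.
(* No positive multiple of [p ^ M.+1] or of a larger prime is among these early terms. The [.+4]
   secures both [3 < n] and [N <= n - 1] below. *)
pose M := \max_(i < N.+4) a i.
have leM i : i < N.+4 -> a i <= M.
  by move=> lt_i; apply: (leq_bigmax (Ordinal lt_i)).
have pM_gt : M < p ^ M.+1 by apply: ltnW; apply: ltn_expl; apply: prime_gt1.
have [q [m [q_pr lt_q m_gt0 q_dvd]]] := yellowstone_large_prime (p ^ M.+1).
have ex_n : exists n, (0 < n) && (q %| a n) by exists m; rewrite m_gt0.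
(* At the first term divisible by [q], the factor shared with [a (n - 2)] must come from the
   cofactor of [q], so [q] can be exchanged. *)
case: (ex_minnP ex_n) => n /andP[n_gt0 qn] min_n.
have le_n : N.+4 <= n.
  rewrite leqNgt; apply/negP => /leM; rewrite leqNgt => /negP; apply.
  apply: (ltn_trans pM_gt); apply: (leq_trans lt_q).
  by rewrite dvdn_leq ?yellowstone_gt0.
have n_gt3 : 3 < n by apply: leq_trans le_n.
have [an_gt0 _ g1 co] := yellowstone_stepP n_gt3.
have n1_lt : n - 1 < n by rewrite ltn_subrL n_gt0.
have n2_lt : n - 2 < n by rewrite ltn_subrL n_gt0.
have n2_gt0 : 0 < n - 2 by rewrite subn_gt0 (leq_trans _ n_gt3).
have le_N1 : N <= n - 1 by rewrite leq_subRL // (leq_trans _ le_n) // add1n !ltnS !leqW.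
have q_nd2 : ~~ (q %| a (n - 2)).
  apply/negP => qd; have := min_n (n - 2).
  by rewrite n2_gt0 qd leqNgt n2_lt => /(_ isT).
case/dvdnP: qn => k an_eq.
have k_gt0 : 0 < k by move: an_gt0; rewrite an_eq muln_gt0 => /andP[].
have pe_gt0 : 0 < p ^ M.+1 by rewrite expn_gt0 prime_gt0.
have : a n <= k * p ^ M.+1.
  apply: yellowstone_min => //.
  - by rewrite muln_gt0 k_gt0.
  (* An earlier occurrence would be divisible by [p], hence have index below [N] and be at most [M],
     yet it is at least [p ^ M.+1]. *)
  - move=> i /andP[i_gt0 lt_in]; apply/eqP => ai_eq.
    have p_dvd : p %| a i by rewrite ai_eq expnS dvdn_mull // dvdn_mulr.
    have lt_iN : i < N.
      by rewrite ltnNge; apply/negP => /p_ndvd; rewrite p_dvd.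
    have := leM i (leqW (leqW (leqW (leqW lt_iN)))).
    by rewrite ai_eq leqNgt (leq_trans pM_gt) // leq_pmull.
  - have g_eq : gcdn (a (n - 2)) (a n) = gcdn (a (n - 2)) k.
      by rewrite an_eq Gauss_gcdl // coprime_sym prime_coprime.
    apply: (leq_trans g1); rewrite g_eq dvdn_leq //.
      by rewrite gcdn_gt0 muln_gt0 k_gt0 pe_gt0 orbT.
    by rewrite dvdn_gcd dvdn_gcdl dvdn_mulr // dvdn_gcdr.
  - rewrite coprimeMr coprimeXr ?andbT; last first.
      by rewrite coprime_sym prime_coprime // p_ndvd.
    by move: co; rewrite an_eq coprimeMr => /andP[].
by rewrite an_eq leq_pmul2l // leqNgt lt_q.
Qed.

(** Once all terms exceed [k], a factor shared with [a n] but none with [a n.+1] would make [k]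
    admissible at [n.+2] and give [a n.+2 <= k]. A prime factor of [k] dividing a late term starts
    the induction. *)
Lemma yellowstone_missing_persists k :
  1 < k -> (forall n, 0 < n -> a n != k) ->
  exists2 N, 0 < N & forall n, N <= n -> 1 < gcdn (a n) k.
Proof.
move=> k_gt1 missing.
have [N large] := injective_unbounded yellowstone_inj k.
(* The [2] puts index [n.+2] above 3, where the recursion applies. *)
have [n0 le_n0 p_dvd] :=
  yellowstone_prime_infinitely_often (maxn N 2) (pdiv_prime k_gt1).
move: le_n0; rewrite geq_max => /andP[le_N n0_gt1].
exists n0; first exact: ltnW.
elim=> [|n IHn]; first by rewrite leqn0 => /eqP n00; rewrite n00 in n0_gt1.
rewrite leq_eqVlt => /orP[/eqP <-|].
  apply: gcdn_gt1_dvd p_dvd (pdiv_dvd k);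
    by rewrite ?(ltnW k_gt1) ?prime_gt1 ?pdiv_prime.
rewrite ltnS => le_n; have gn := IHn le_n.
have : gcdn (a n.+1) k != 1.
  apply/eqP => co; have := large n.+2; rewrite ltnNge.
  rewrite yellowstone_min ?subn1 ?subSS ?subn0 ?(ltnW k_gt1) //.
  - by move/(_ (leqW (leqW (leq_trans le_N le_n)))).
  - by rewrite !ltnS (leq_trans n0_gt1).
  - by move=> i /andP[i_gt0 _]; apply: missing.
  - by apply/eqP.
have : 0 < gcdn (a n.+1) k by rewrite gcdn_gt0 (ltnW k_gt1) orbT.
by case: gcdn => [|[|g]].
Qed.

Lemma yellowstone_prime_occurs p : prime p -> exists2 n, 0 < n & a n = p.
Proof.
move=> p_pr; apply: NNPP => none.
have [|N N_gt0 persists] := yellowstone_missing_persists (prime_gt1 p_pr).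
  by move=> n n_gt0; apply/eqP => an; apply: none; exists n.
(* For a prime, sharing a factor means divisibility, so two consecutive terms would share [p]. *)
have dvd n : N <= n -> p %| a n.
  move/persists; apply: contraTT; rewrite -prime_coprime // coprime_sym.
  by rewrite /coprime => /eqP ->.
have := yellowstone_coprime N_gt0; apply/negP.
by rewrite /coprime gtn_eqF // (gcdn_gt1_dvd (prime_gt1 p_pr)) ?yellowstone_gt0 ?dvd.
Qed.

Lemma yellowstone_occurs k : 0 < k -> exists2 n, 0 < n & a n = k.
Proof.
rewrite leq_eqVlt => /orP[/eqP <-|k_gt1]; first by exists 1; case: ha.
apply: NNPP => none.
have [|N N_gt0 persists] := yellowstone_missing_persists k_gt1.
  by move=> n n_gt0; apply/eqP => an; apply: none; exists n.
pose M := \max_(i < N) a i.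
(* Exceeding [M] forces [q] to occur at an index at least [N]; exceeding [k] makes it coprime to
   [k]. *)
have [q lt_q q_pr] := prime_above (maxn k M).
move: lt_q; rewrite gtn_max => /andP[lt_kq lt_Mq].
have [n n_gt0 an] := yellowstone_prime_occurs q_pr.
have le_Nn : N <= n.
  rewrite leqNgt; apply/negP => lt_nN.
  have := leq_bigmax (F := fun i : 'I_N => a i) (Ordinal lt_nN).
  by rewrite /= an leqNgt lt_Mq.
have := persists n le_Nn; rewrite an; apply/negP.
suff /eqP -> : coprime q k by [].
by rewrite prime_coprime //; apply/negP => /(dvdn_leq (ltnW k_gt1)); rewrite leqNgt lt_kq.
Qed.

End Yellowstone.

Theorem theorem1 (a : nat -> nat) (ha : is_yellowstone a) :
  (forall n : nat, 0 < n -> 0 < a n) /\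
  (forall m : nat, 0 < m -> exists! n : nat, 0 < n /\ a n = m).
Proof.
split=> [n|m m_gt0]; first exact: yellowstone_gt0.
have [n n_gt0 an] := yellowstone_occurs ha m_gt0.
exists n; split=> // n' [n'_gt0 an'].
by apply: (yellowstone_inj ha); rewrite ?inE // an an'.
Qed.
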